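(* Let $p$ be a prime and $N\ge1$. Let $\mathrm{Bad}_p(N)$ be the set of $(x_1,\dots,x_N)\in\mathbb Z_p^N$ for which there is $c>0$ with $$\max\{|qx_1-r_1|_p,\dots,|qx_N-r_N|_p\}\ge c\,\max\{|r_1|,\dots,|r_N|,|q|\}^{-\frac{N+1}{N}}$$ for every $(r_1,\dots,r_N,q)\in\mathbb Z^N\times(\mathbb Z\setminus\{0\})$. Then for any ball $B$ of $\mathbb Z_p^N$ and any non-trivial splitting structure of $\mathbb Z_p^N$ with $d:=\dim A_\infty(B)>N-1$, the set $\mathrm{Bad}_p(N)$ is $\frac{d-N+1}{d}$-Cantor-winning on $B$. In particular, $\mathrm{Bad}_p(N)$ is $\frac1N$-Cantor-winning with respect to the canonical splitting structure of $\mathbb Z_p^N$.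
   Context: $\mathbb Z_p^N$ carries the metric $\mathbf d(x,y)=\max_i|x_i-y_i|_p$. For a metric space with closed balls (each with centre and radius $\mathrm{rad}$), a splitting structure is a quadruple $(X,\mathcal S,U,f)$ where $U\subset\mathbb N$ is an infinite multiplicatively closed set such that $u,v\in U$, $u\mid v$ imply $v/u\in U$; $f:U\to\mathbb N$ is completely multiplicative; $\mathcal S$ assigns to each ball $B$ and $u\in U$ a collection $\mathcal S(B,u)$ of closed balls contained in $B$ of radius $\mathrm{rad}(B)/u$ with (S1) $\#\mathcal S(B,u)=f(u)$; (S2) distinct members have centres at distance $\ge2\mathrm{rad}(B)/u$; (S3) $\mathcal S(B,uv)=\bigcup_{b\in\mathcal S(B,u)}\mathcal S(b,v)$. Non-trivial means $f\not\equiv1$. $A_u(B):=\bigcup_{b\in\mathcal S(B,u)}b$, $A_\infty(B):=\bigcap_iA_{u_i}(B)$ for $u_i\in U$, $u_i\mid u_{i+1}$, $u_i\to\infty$; $\dim$ is Hausdorff dimension. Canonical splitting structure: $U=\{p^k:k\ge0\}$, $f(p^k)=p^{Nk}$, $\mathcal S(B,p^k)$ is the set of all closed balls of radius $\mathrm{rad}(B)/p^k$ contained in $B$. Generalised Cantor sets: given $B$, $R\in U$ and reals $\mathbf r=(r_{m,n})_{0\le m\le n}$, set $\mathcal B_0=\{B\}$; given $\mathcal B_n$, let $\mathcal I_{n+1}=\bigcup_{B_n\in\mathcal B_n}\mathcal S(B_n,R)$, $\mathcal I^{n+1}_{n+1}:=\mathcal I_{n+1}$, and for $k=0,\dots,n$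 obtain $\mathcal I^{n-k}_{n+1}\subseteq\mathcal I^{n-k+1}_{n+1}$ by removing, for each $B_{n-k}\in\mathcal B_{n-k}$, at most $r_{n-k,n}$ balls from $\mathcal S(B_{n-k},R^{k+1})\cap\mathcal I^{n-k+1}_{n+1}$; put $\mathcal B_{n+1}:=\mathcal I^0_{n+1}$. Any resulting $\bigcap_n\bigcup_{b\in\mathcal B_n}b$ is a $(B,R,\mathbf r)$-Cantor set. A set $K$ is $\epsilon_0$-Cantor-winning on $B$ if for every $0<\epsilon<\epsilon_0$ there is $R_\epsilon\in U$ such that for all $R\in U$, $R\ge R_\epsilon$, $K$ contains some $(B,R,\mathbf r)$-Cantor set with $r_{m,n}=f(R)^{(n-m+1)(1-\epsilon)}$ for all $0\le m\le n$; $\epsilon_0$-Cantor-winning means this for every ball $B$. *)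

(* Defs.v *)
From HB Require Import structures.
From mathcomp Require Import all_boot all_order all_algebra.
From mathcomp Require Import all_classical all_reals all_analysis.

Set Implicit Arguments.
Unset Strict Implicit.
Unset Printing Implicit Defensive.

Import Order.TTheory GRing.Theory Num.Theory.
Local Open Scope classical_set_scope.
Local Open Scope ring_scope.

(* Z_p as the inverse limit of the Z/p^k: [res x k] is the representative in
   [0, p^k) of x modulo p^k, so the compatibility condition also forces
   [res x k] to be reduced.  The ring structure makes sense for all p. *)
Record padic_int (p : nat) := PadicInt {
  res : nat -> int;
  resP : forall k, (res k.+1 %% (p ^ k)%N)%Z = res k }.

HB.instance Definition _ p := gen_eqMixin (padic_int p).
HB.instance Definition _ p := gen_choiceMixin (padic_int p).

Section PadicRing.
Variable p : nat.
Implicit Types x y z : padic_int p.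

Lemma padic_eq x y : (forall k, res x k = res y k) -> x = y.
Proof.
case: x y => [x xP] [y yP] /= /funext xy; subst y.
by congr PadicInt; exact: Prop_irrelevance.
Qed.

Lemma modz_pS (k : nat) (m : int) :
  ((m %% (p ^ k.+1)%N)%Z %% (p ^ k)%N)%Z = (m %% (p ^ k)%N)%Z.
Proof.
rewrite {2}(divz_eq m (p ^ k.+1)%N) expnS PoszM mulrA modzMDl.
by rewrite -PoszM -expnS.
Qed.

Lemma res_mod x k : (res x k %% (p ^ k)%N)%Z = res x k.
Proof. by rewrite -(resP x k) modz_mod. Qed.

Definition padic_of (F : nat -> int)
    (FP : forall k, (F k.+1 = F k %[mod (p ^ k)%N])%Z) : padic_int p.
Proof.
exists (fun k => (F k %% (p ^ k)%N)%Z) => k.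
by rewrite modz_pS FP.
Defined.

Fact padic_const_subproof (m : int) (k : nat) : (m = m %[mod (p ^ k)%N])%Z.
Proof. by []. Qed.

Fact padic_add_subproof x y k :
  (res x k.+1 + res y k.+1 = res x k + res y k %[mod (p ^ k)%N])%Z.
Proof. by rewrite -modzDm !resP. Qed.

Fact padic_opp_subproof x k :
  (- res x k.+1 = - res x k %[mod (p ^ k)%N])%Z.
Proof. by rewrite -modzNm resP. Qed.

Fact padic_mul_subproof x y k :
  (res x k.+1 * res y k.+1 = res x k * res y k %[mod (p ^ k)%N])%Z.
Proof. by rewrite -modzMm !resP. Qed.

Definition padic_zero := padic_of (padic_const_subproof 0).
Definition padic_one := padic_of (padic_const_subproof 1).
Definition padic_add x y := padic_of (padic_add_subproof x y).
Definition padic_opp x := padic_of (padic_opp_subproof x).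
Definition padic_mul x y := padic_of (padic_mul_subproof x y).

Fact padic_addA : associative padic_add.
Proof. by move=> x y z; apply: padic_eq => k /=; rewrite modzDmr modzDml addrA. Qed.
Fact padic_addC : commutative padic_add.
Proof. by move=> x y; apply: padic_eq => k /=; rewrite addrC. Qed.
Fact padic_add0 : left_id padic_zero padic_add.
Proof. by move=> x; apply: padic_eq => k /=; rewrite modzDml add0r res_mod. Qed.
Fact padic_addN : left_inverse padic_zero padic_opp padic_add.
Proof. by move=> x; apply: padic_eq => k /=; rewrite modzDml addNr. Qed.

HB.instance Definition _ := GRing.isZmodule.Build (padic_int p)
  padic_addA padic_addC padic_add0 padic_addN.

Fact padic_mulA : associative padic_mul.
Proof. by move=> x y z; apply: padic_eq => k /=; rewrite modzMmr modzMml mulrA. Qed.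
Fact padic_mulC : commutative padic_mul.
Proof. by move=> x y; apply: padic_eq => k /=; rewrite mulrC. Qed.
Fact padic_mul1 : left_id padic_one padic_mul.
Proof. by move=> x; apply: padic_eq => k /=; rewrite modzMml mul1r res_mod. Qed.
Fact padic_mulD : left_distributive padic_mul +%R.
Proof.
by move=> x y z; apply: padic_eq => k /=; rewrite modzMml modzDm mulrDl.
Qed.

HB.instance Definition _ := GRing.Zmodule_isComPzRing.Build (padic_int p)
  padic_mulA padic_mulC padic_mul1 padic_mulD.

End PadicRing.

(* [ex_minn h] is the p-adic valuation of x: the least k such that x is nonzero
   modulo p^(k+1). *)
Definition padic_norm (R : realType) (p : nat) (x : padic_int p) : R :=
  match pselect (exists k, res x k.+1 != 0) with
  | left h => p%:R ^- ex_minn h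
  | right _ => 0
  end.

Definition padic_dist (R : realType) (p N : nat)
    (x y : 'rV[padic_int p]_N) : R :=
  \big[Num.max/0]_(i < N) padic_norm R (x 0 i - y 0 i).

Section Hausdorff.
Variables (R : realType) (X : Type) (dist : X -> X -> R).
Local Open Scope ereal_scope.

Definition hausdorff_diam (V : set X) : \bar R :=
  ereal_sup [set (dist xy.1 xy.2)%:E | xy in V `*` V].

(* The empty set has weight 0 for every exponent, including s = 0. *)
Definition hausdorff_weight (s : R) (V : set X) : \bar R :=
  if V == set0 then 0 else hausdorff_diam V `^ s.

Definition hausdorff_premeasure (s delta : R) (A : set X) : \bar R :=
  ereal_inf [set \sum_(0 <= i <oo) hausdorff_weight s (V i) | V in
    [set V : nat -> set X | A `<=` \bigcup_i V i /\
                            forall i, hausdorff_diam (V i) <= delta%:E]].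

Definition hausdorff_measure (s : R) (A : set X) : \bar R :=
  ereal_sup [set hausdorff_premeasure s delta A | delta in
    [set delta : R | (0 < delta)%R]].

Definition hausdorff_dim (A : set X) : \bar R :=
  ereal_inf [set s%:E | s in
    [set s : R | (0 <= s)%R /\ hausdorff_measure s A = 0]].

End Hausdorff.

(* A closed ball is a centre together with a radius p^-j, j >= 0, i.e. a nonzero
   value of the metric (this matters, since radii are compared with distances
   in [spl_sep]).  Distinct balls may have the same points. *)
Record pball (p N : nat) := PBall {
  cent : 'rV[padic_int p]_N;
  rad_exp : nat }.

Section Balls.
Variables (R : realType) (p N : nat).
Implicit Types B b : pball p N.

Definition pball_rad B : R := p%:R ^- rad_exp B.

Definition pball_set B : set 'rV[padic_int p]_N :=
  [set x : 'rV[padic_int p]_N | padic_dist R (cent B) x <= pball_rad B].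

End Balls.

Record splitting_structure (R : realType) (p N : nat) := SplittingStructure {
  spl : pball p N -> nat -> set (pball p N);
  splU : set nat;
  splf : nat -> nat;
  splU_gt0 : forall u, splU u -> (0 < u)%N;
  splU_infinite : infinite_set splU;
  splU_mul : forall u v, splU u -> splU v -> splU (u * v)%N;
  splU_div : forall u v, splU u -> splU v -> (u %| v)%N -> splU (v %/ u)%N;
  splf_gt0 : forall u, splU u -> (0 < splf u)%N;
  splf_mul : forall u v, splU u -> splU v -> splf (u * v) = (splf u * splf v)%N;
  spl_sub : forall B u b, splU u -> spl B u b ->
    pball_set R b `<=` pball_set R B;
  spl_rad : forall B u b, splU u -> spl B u b -> pball_rad R b = pball_rad R B / u%:R;
  spl_card : forall B u, splU u -> (spl B u #= `I_(splf u))%card;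
  spl_sep : forall B u b b', splU u -> spl B u b -> spl B u b' -> b <> b' ->
    2 * pball_rad R B / u%:R <= padic_dist R (cent b) (cent b');
  spl_comp : forall B u v, splU u -> splU v ->
    spl B (u * v)%N = \bigcup_(b in spl B u) spl b v }.

Section Splitting.
Variables (R : realType) (p N : nat) (S : splitting_structure R p N).
Implicit Types (B b : pball p N) (K C : set 'rV[padic_int p]_N).

Definition nontrivial_splitting : Prop := exists2 u, splU S u & splf S u <> 1%N.

Definition union_balls (F : set (pball p N)) : set 'rV[padic_int p]_N :=
  \bigcup_(b in F) pball_set R b.

Definition divisibility_chain (u : nat -> nat) : Prop :=
  [/\ forall i, splU S (u i), forall i, (u i %| u i.+1)%N & u @ \oo --> \oo].

Definition A_infty (u : nat -> nat) B : set 'rV[padic_int p]_N :=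
  \bigcap_i union_balls (spl S B (u i)).

(* S(B, p^k) consists of all closed balls of radius rad(B)/p^k contained in B,
   each taken with one centre: the balls are compared as sets of points, and
   [spl_sep] prevents two members of S(B, p^k) from having the same points.
   See [canonical_exists] below. *)
Definition canonical_splitting : Prop :=
  [/\ splU S = [set (p ^ k)%N | k in [set: nat]],
      forall k, splf S (p ^ k) = (p ^ (N * k))%N &
      forall B k,
        [set pball_set R b | b in spl S B (p ^ k)%N] =
        [set pball_set R b | b in
          [set b | pball_rad R b = pball_rad R B / (p ^ k)%:R /\
                   pball_set R b `<=` pball_set R B]]].

(* J is obtained from I by removing, for each b in F, at most t balls of
   S(b, u) `&` I, namely those of [rem b]. *)
Definition removal (F : set (pball p N)) (u : nat) (t : R)
    (I J : set (pball p N)) : Prop :=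
  exists rem : pball p N -> set (pball p N),
    (forall b, F b -> rem b `<=` spl S b u `&` I /\
       exists2 l : nat, (rem b #= `I_l)%card & l%:R <= t) /\
    J = I `\` \bigcup_(b in F) rem b.

(* With [Bn n] the n-th collection of balls and, for a given n, [I m] the
   intermediate collection with upper index m, 0 <= m <= n + 1, between level n
   and level n + 1. *)
Definition cantor_collections B (Q : nat) (r : nat -> nat -> R)
    (Bn : nat -> set (pball p N)) : Prop :=
  Bn 0%N = [set B] /\
  forall n, exists I : nat -> set (pball p N),
    [/\ I n.+1 = \bigcup_(b in Bn n) spl S b Q,
        forall k, (k <= n)%N ->
          removal (Bn (n - k)%N) (Q ^ k.+1) (r (n - k)%N n)
                  (I (n - k).+1) (I (n - k)%N) &
        Bn n.+1 = I 0%N].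

Definition cantor_set B (Q : nat) (r : nat -> nat -> R) C : Prop :=
  exists2 Bn, cantor_collections B Q r Bn & C = \bigcap_n union_balls (Bn n).

Definition cantor_winning_on (eps0 : R) K B : Prop :=
  forall eps : R, 0 < eps -> eps < eps0 ->
    exists2 Qeps, splU S Qeps & forall Q, splU S Q -> (Qeps <= Q)%N ->
      exists2 C, cantor_set B Q
        (fun m n => (splf S Q)%:R `^ ((n - m).+1%:R * (1 - eps))) C & C `<=` K.

Definition cantor_winning (eps0 : R) K : Prop :=
  forall B, cantor_winning_on eps0 K B.

End Splitting.

Definition int_height (R : realType) (N : nat) (r : 'I_N -> int) (q : int) : R :=
  Num.max (\big[Num.max/0]_(i < N) `|r i|%:~R) `|q|%:~R.

Definition Bad (R : realType) (p N : nat) : set 'rV[padic_int p]_N :=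
  [set x : 'rV[padic_int p]_N | exists2 c : R, 0 < c &
    forall (r : 'I_N -> int) (q : int), q != 0 ->
      \big[Num.max/0]_(i < N) padic_norm R (q%:~R * x 0 i - (r i)%:~R) >=
      c * int_height R r q `^ (- (N.+1%:R / N%:R))].

Section CanonicalExists.
Variables (R : realType) (p N : nat) (p_pr : prime p).
Implicit Types (x y : padic_int p) (B b : pball p N).

Let p_gt1 : (1 < p)%N := prime_gt1 p_pr.
Let p_gt0 : (0 < p)%N := prime_gt0 p_pr.
Let pR_gt0 : 0 < p%:R :> R. Proof. by rewrite ltr0n. Qed.
Let pR_gt1 : 1 < p%:R :> R. Proof. by rewrite ltr1n. Qed.

Lemma res_le x (j k : nat) : (j <= k)%N -> (res x k %% (p ^ j)%N)%Z = res x j.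
Proof.
elim: k => [|k IH]; first by rewrite leqn0 => /eqP ->; exact: res_mod.
rewrite leq_eqVlt => /orP[/eqP ->|jk]; first exact: res_mod.
rewrite -IH // -(resP x k) -(subnKC (_ : j <= k)%N) // expnD.
set d := (p ^ j)%N; set m := res x _.
rewrite {1}(divz_eq m (d * p ^ (k - j))%N) [X in _ * X]PoszM [X in _ * X]mulrC.
by rewrite mulrA modzMDl.
Qed.

Lemma res_sub0 x y k : (res (x - y) k == 0) = (res x k == res y k).
Proof.
have -> : res (x - y) k = ((res x k - res y k) %% (p ^ k)%N)%Z.
  by rewrite /= modzDmr.
by rewrite -(mod0z (p ^ k)%N) eqz_mod_dvd subr0 -eqz_mod_dvd !res_mod.
Qed.

Lemma res_nat m k : res (m%:R : padic_int p) k = (m %% p ^ k)%N.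
Proof.
elim: m => [|m IH]; first by rewrite /= mod0z mod0n.
rewrite -natr1 -modz_nat.
have -> : res (m%:R + 1 : padic_int p) k =
  ((res (m%:R : padic_int p) k + (1 %% (p ^ k)%N)%Z) %% (p ^ k)%N)%Z by [].
by rewrite IH -modz_nat modzDmr modzDml -addn1 PoszD.
Qed.

Lemma res_addn x m k :
  res (x + m%:R) k = ((res x k + m%:Z) %% (p ^ k)%N)%Z.
Proof.
have -> : res (x + m%:R) k =
  ((res x k + res (m%:R : padic_int p) k) %% (p ^ k)%N)%Z by [].
by rewrite res_nat -modz_nat modzDmr.
Qed.

Lemma norm_le x k : (padic_norm R x <= p%:R ^- k) = (res x k == 0).
Proof.
have res00 : res x 0 = 0 by rewrite -(res_mod x 0) expn0 modz1.
rewrite /padic_norm; case: pselect => [h|h].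
  case: ex_minnP => m m0 mmin.
  rewrite lef_pV2 ?posrE ?exprn_gt0 // ler_eXn2l //.
  apply/idP/idP => [|/eqP xk].
    case: k => [|k] km; first by rewrite res00.
    apply/negPn/negP => /mmin; by rewrite leqNgt km.
  rewrite leqNgt; apply: contra m0 => mk.
  by rewrite -(res_le x mk) xk mod0z.
rewrite invr_ge0 exprn_ge0 ?ler0n //; apply/esym.
case: k => [|k]; first by rewrite res00.
by apply/negPn/negP => xk; apply: h; exists k.
Qed.

Lemma norm_gt x k : res x k.+1 != 0 -> p%:R ^- k <= padic_norm R x.
Proof.
move=> xk; rewrite /padic_norm; case: pselect => [h|[]]; last by exists k.
case: ex_minnP => m m0 mmin.
by rewrite lef_pV2 ?posrE ?exprn_gt0 // ler_eXn2l // mmin.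
Qed.

Lemma pball_setE B : pball_set R B =
  [set y | forall i, res (cent B 0 i) (rad_exp B) = res (y 0 i) (rad_exp B)].
Proof.
apply/seteqP; split => y; rewrite /pball_set /padic_dist /pball_rad /=.
  move=> /bigmax_leP[_ h] i; apply/eqP; rewrite -res_sub0 -norm_le.
  exact: h.
move=> h; apply/bigmax_leP; split.
  by rewrite invr_ge0 exprn_ge0 ?ler0n.
by move=> i _; rewrite norm_le res_sub0 h.
Qed.

(* The centres of the canonical subballs of B are cent(B) + rad(B)^-1 * a with
   a in {0, ..., p^k - 1}^N; this choice is compatible with [spl_comp]. *)
Definition subball B k (a : {ffun 'I_N -> 'I_(p ^ k)}) : pball p N :=
  PBall (\row_i (cent B 0 i + (p ^ rad_exp B * a i)%:R)) (rad_exp B + k).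

Definition can_spl B u : set (pball p N) := range (@subball B (logn p u)).

Let can_U : set nat := [set (p ^ k)%N | k in [set: nat]].
Let can_f (u : nat) := (u ^ N)%N.

Lemma res_subball B k a i :
  res (cent (@subball B k a) 0 i) (rad_exp B) = res (cent B 0 i) (rad_exp B).
Proof.
by rewrite /= mxE res_addn PoszM addrC mulrC modzMDl res_mod.
Qed.

Lemma subball_res_inj B k (a a' : {ffun 'I_N -> 'I_(p ^ k)}) i :
  res (cent (subball B a) 0 i) (rad_exp B + k) =
  res (cent (subball B a') 0 i) (rad_exp B + k) -> a i = a' i.
Proof.
rewrite /= !mxE !res_addn => /eqP; rewrite eqz_modDl !modz_nat eqz_nat.
rewrite expnD -!muln_modr !modn_small // eqn_pmul2l ?expn_gt0 ?p_gt0 //.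
by move=> /eqP h; exact: val_inj.
Qed.

Lemma subball_inj B k : injective (@subball B k).
Proof.
by move=> a a' aa'; apply/ffunP => i; apply: (@subball_res_inj B k a a' i); rewrite aa'.
Qed.

Lemma rad_subball B k a : pball_rad R (@subball B k a) = pball_rad R B / (p ^ k)%:R.
Proof. by rewrite /pball_rad /= exprD invfM natrX. Qed.

Lemma sub_subball B k a : pball_set R (@subball B k a) `<=` pball_set R B.
Proof.
rewrite !pball_setE => y /= h i; rewrite -(res_subball B a i).
have := h i; rewrite /= => hi.
by rewrite -(res_le _ (leq_addr k _)) /= hi res_le // leq_addr.
Qed.

Lemma card_subball B k :
  (range (@subball B k) #= `I_((p ^ k) ^ N))%card.
Proof.
apply: card_eq_trans (inj_card_eq _) _; first by move=> a a' _ _ /subball_inj.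
have -> : ((p ^ k) ^ N)%N = #|{ffun 'I_N -> 'I_(p ^ k)}|.
  by rewrite card_ffun !card_ord.
rewrite card_eq_sym; apply: card_eq_trans card_II _.
have -> : [set: {ffun 'I_N -> 'I_(p ^ k)}] =
   enum_val @` [set: 'I_#|{ffun 'I_N -> 'I_(p ^ k)}|].
  by apply/seteqP; split => a // _; exists (enum_rank a); rewrite ?enum_rankK.
rewrite card_eq_sym; apply: inj_card_eq => a a' _ _; exact: enum_val_inj.
Qed.

Lemma sep_subball B k a a' : @subball B k a <> @subball B k a' ->
  2 * pball_rad R B / (p ^ k)%:R <=
    padic_dist R (cent (subball B a)) (cent (subball B a')).
Proof.
move=> neq.
have [i ai] : exists i, a i != a' i.
  apply/existsP; rewrite -negb_forall; apply/negP => /forallP h; apply: neq.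
  by congr subball; apply/ffunP => i; exact/eqP.
set E := (rad_exp B + k)%N.
have ri : res (cent (subball B a) 0 i - cent (subball B a') 0 i) E != 0.
  by rewrite res_sub0; apply: contra ai => /eqP /subball_res_inj ->.
have -> : 2 * pball_rad R B / (p ^ k)%:R = 2 * p%:R ^- E.
  by rewrite -mulrA -(rad_subball B a).
apply: (@le_trans _ _ (padic_norm R
   (cent (subball B a) 0 i - cent (subball B a') 0 i))); last first.
  exact: (@le_bigmax _ _ _ 0 (fun i => padic_norm R
    (cent (subball B a) 0 i - cent (subball B a') 0 i)) i).
case: E ri => [|e] ri.
  by move: ri; rewrite -(res_mod _ 0) expn0 modz1.
apply: le_trans (norm_gt ri).
rewrite exprS invfM mulrA ler_piMl ?invr_ge0 ?exprn_ge0 ?ler0n //.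
by rewrite ler_pdivrMr // mul1r ler_nat.
Qed.

Lemma comp_subball B k l :
  range (@subball B (k + l)) =
  \bigcup_(b in range (@subball B k)) range (@subball b l).
Proof.
have pk_gt0 m : (0 < p ^ m)%N by rewrite expn_gt0 p_gt0.
apply/seteqP; split => [b [a _ <-]|b [_ [a _ <-] [a' _ <-]]].
  pose a1 : {ffun 'I_N -> 'I_(p ^ k)} :=
    [ffun i => Ordinal (ltn_pmod (a i) (pk_gt0 k))].
  have a2P i : (a i %/ p ^ k < p ^ l)%N.
    by rewrite ltn_divLR // mulnC -expnD.
  exists (subball B a1); first by exists a1.
  exists [ffun i => Ordinal (a2P i)] => //.
  rewrite /subball /= addnA; congr PBall; apply/rowP => i.
  rewrite !mxE !ffunE /= -addrA -natrD; congr (_ + _%:R).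
  rewrite (expnD p (rad_exp B) k) -mulnA -mulnDr addnC; congr (_ * _)%N.
  by rewrite mulnC -divn_eq.
have a2P i : (a i + p ^ k * a' i < p ^ (k + l))%N.
  rewrite expnD; apply: (@leq_trans (p ^ k + p ^ k * a' i)).
    by rewrite ltn_add2r.
  by rewrite -mulnS leq_mul2l ltn_ord orbT.
exists [ffun i => Ordinal (a2P i)] => //.
rewrite /subball /= addnA; congr PBall; apply/rowP => i.
rewrite !mxE !ffunE /= -addrA -natrD; congr (_ + _%:R).
by rewrite (expnD p (rad_exp B) k) -mulnA -mulnDr.
Qed.

Lemma all_subball B k b :
  pball_rad R b = pball_rad R B / (p ^ k)%:R -> pball_set R b `<=` pball_set R B ->
  exists a, pball_set R (@subball B k a) = pball_set R b.
Proof.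
have pk_gt0 m : (0 < p ^ m)%N by rewrite expn_gt0 p_gt0.
move=> rb sub.
have eb : rad_exp b = (rad_exp B + k)%N.
  move: rb; rewrite /pball_rad natrX -invfM -exprD => /invr_inj.
  by apply: ieexprIn; rewrite ?gt_eqF.
have cb i : res (cent B 0 i) (rad_exp B) = res (cent b 0 i) (rad_exp B).
  by have := sub (cent b); rewrite !pball_setE; apply.
pose E := (rad_exp B + k)%N.
pose D i := absz (res (cent b 0 i - cent B 0 i) E).
have DE i : (D i)%:Z = res (cent b 0 i - cent B 0 i) E.
  by rewrite /D gez0_abs // -res_mod modz_ge0 // eqz_nat -lt0n.
have Dlt i : (D i < p ^ E)%N.
  by rewrite -ltz_nat DE -res_mod ltz_pmod // ltz_nat.
have Ddv i : (p ^ rad_exp B %| D i)%N.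
  have /eqP : res (cent b 0 i - cent B 0 i) (rad_exp B) == 0.
    by rewrite res_sub0 cb.
  rewrite -(res_le _ (leq_addr k _)) -/E -DE modz_nat => -[/eqP].
  by [].
have aP i : (D i %/ p ^ rad_exp B < p ^ k)%N.
  by rewrite ltn_divLR // mulnC -expnD.
pose a : {ffun 'I_N -> 'I_(p ^ k)} := [ffun i => Ordinal (aP i)].
have key i : res (cent (subball B a) 0 i) E = res (cent b 0 i) E.
  rewrite [cent _]/= mxE ffunE [nat_of_ord _]/= mulnC divnK // res_addn DE.
  have {2}-> : cent b 0 i = cent B 0 i + (cent b 0 i - cent B 0 i).
    by rewrite addrC subrK.
  by [].
exists a; rewrite !pball_setE eb; apply/seteqP; split => y h i.
  by rewrite -key; exact: h.
by rewrite [rad_exp _]/= key; exact: h.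
Qed.

Lemma canonical_exists : exists S : splitting_structure R p N, canonical_splitting S.
Proof.
have log k : logn p (p ^ k) = k by exact: pfactorK.
unshelve eexists (@SplittingStructure R p N can_spl can_U can_f
  _ _ _ _ _ _ _ _ _ _ _).
- by move=> _ [k _ <-]; rewrite expn_gt0 p_gt0.
- apply/infiniteP; rewrite /can_U.
  have inj : {in [set: nat] &, injective (fun k => p ^ k)%N}.
    by move=> k l _ _ /eqP; rewrite eqn_exp2l // => /eqP.
  by have /card_eqPle[] := inj_card_eq inj.
- by move=> _ _ [k _ <-] [l _ <-]; exists (k + l)%N; rewrite ?expnD.
- move=> _ _ [k _ <-] [l _ <-] dv; exists (l - k)%N => //.
  have kl : (k <= l)%N by rewrite -(dvdn_Pexp2l _ _ p_gt1).
  by rewrite expnB.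
- by move=> _ [k _ <-]; rewrite /can_f !expn_gt0 p_gt0.
- by move=> u v _ _; rewrite /can_f expnMn.
- by move=> B _ b [k _ <-] [a _ <-]; exact: sub_subball.
- by move=> B _ b [k _ <-] [a _ <-]; rewrite rad_subball log.
- by move=> B _ [k _ <-]; rewrite /can_f -{2}(log k); exact: card_subball.
- move=> B _ b b' [k _ <-] ; rewrite /can_spl log.
  by move=> [a _ <-] [a' _ <-]; exact: sep_subball.
- move=> B _ _ [k _ <-] [l _ <-]; rewrite /can_spl -expnD !log.
  exact: comp_subball.
split => [//|k|B k]; first by rewrite /= /can_f -expnM mulnC.
apply/seteqP; split => [_ [b /= [a _ <-] <-]|_ [b [rb sb] <-]].
  exists (subball B a) => //; split; last exact: sub_subball.
  by rewrite rad_subball log.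
have [a <-] : exists a, pball_set R (@subball B (logn p (p ^ k)) a) = pball_set R b.
  by rewrite log; exact: all_subball.
by exists (subball B a) => //; exists a.
Qed.

End CanonicalExists.

(* Main.v *)
Require Import Defs.
From HB Require Import structures.
From mathcomp Require Import all_boot all_order all_algebra.
From mathcomp Require Import perm zify ring lra.
From mathcomp Require Import all_classical all_reals all_analysis.

Set Implicit Arguments.
Unset Strict Implicit.
Unset Printing Implicit Defensive.

Import Order.TTheory GRing.Theory Num.Theory.
Local Open Scope classical_set_scope.
Local Open Scope ring_scope.

(** Every u in U is a power of p, and f(u) = u^a for one exponent a.  Covering
    A_infty(B) by the f(u_i) balls of S(B, u_i) gives d <= a, so that
    eps < (d - N + 1)/d implies Q^(N-1) <= f(Q)^(1 - eps).

    It is therefore enough to remove, from each ball b of level n, at most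
    Q^(N-1) balls of S(b, Q); none of the removals with m < n is needed.  The
    integer vectors (r, q) of height H with (N+1)! H^(N+1) < Q^(nN) that are
    p-adically close to a point of b lie in a lattice of index rad(b)^-N, so by
    the determinant bound they span a proper subspace (simplex lemma).  The
    points close to some r/q are then close to a single p-adic hyperplane, which
    meets at most Q^(N-1) balls of S(b, Q).  Since the heights admitted at level
    n grow like Q^(nN/(N+1)), what survives is badly approximable. *)

(** * Integer determinants and the simplex lemma *)

(** Term by term in the Leibniz expansion. *)
Lemma det_norm_le (n h : nat) (A : 'M[int]_n) :
  (forall i j, (`|A i j| <= h)%N) -> (`|\det A| <= n`! * h ^ n)%N.
Proof.
move=> Ah; rewrite -lez_nat abszE; apply: le_trans (ler_norm_sum _ _ _) _.
have -> : ((n`! * h ^ n)%N : int) = \sum_(s : 'S_n) \prod_(i < n) (h : int).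
  rewrite sumr_const prodr_const card_ord card_Sn -mulr_natl natz PoszM.
  by congr (_ * _); rewrite -natz natrX natz.
apply: ler_sum => s _; rewrite normrM normrX normrN1 expr1n mul1r normr_prod.
by apply: ler_prod => i _; rewrite normr_ge0 -abszE lez_nat Ah.
Qed.

(** Each row is an integer combination of the rows of a triangular matrix of determinant [D ^+ N];
    these generate the lattice of the (r, q) with r congruent to q y modulo [D]. *)
Lemma dvdz_det_congruent (N : nat) (D : int) (y : 'I_N -> int)
    (A : 'M[int]_(N + 1)) :
  (forall k i, (D %| A k (lshift 1 i) - A k (rshift N ord0) * y i)%Z) ->
  (D ^+ N %| \det A)%Z.
Proof.
move=> AD.
(* (r, q) = ((r - q y)/D, q) *m [D, 0; y, 1] *)
pose A' := row_mx (\matrix_(k, i)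
  ((A k (lshift 1 i) - A k (rshift N ord0) * y i) %/ D)%Z) (rsubmx A).
have -> : A = A' *m block_mx D%:M 0 (\row_i y i) 1%:M.
  rewrite mul_row_block mul_mx_scalar mulmx0 mulmx1 add0r -{1}(hsubmxK A).
  congr row_mx; apply/matrixP => k i; rewrite !mxE big_ord1 !mxE mulrC.
  by rewrite divzK ?subrK.
by rewrite det_mulmx det_lblock det_scalar det1 mulr1 dvdz_mull.
Qed.

(** Clear denominators, then divide by the power of p whose exponent is the least valuation of a
    nonzero entry. *)
Lemma primitive_multiple (p n : nat) (w : 'rV[rat]_n) : prime p -> w != 0 ->
  exists2 a : 'I_n -> int, (exists i, ~~ (p %| `|a i|)%N) &
    exists2 c : rat, c != 0 & \row_i (a i)%:~R = c *: w.
Proof.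
move=> p_pr w0.
pose D : rat := (\prod_(j < n) denq (w 0 j))%:~R.
have D0 : D != 0.
  by rewrite intr_eq0 prodf_seq_neq0; apply/allP => j _; exact: denq_neq0.
have zP i : exists z : int, z%:~R = D * w 0 i.
  exists ((\prod_(j < n | j != i) denq (w 0 j)) * numq (w 0 i)).
  by rewrite /D [in RHS](bigD1 i) //= !intrM numqE; ring.
have [z zE] := choice zP.
have [i0 wi0] : exists i, w 0 i != 0.
  by apply/existsP; rewrite -negb_forall; apply: contra w0 => /forallP w0;
    apply/eqP/rowP => i; rewrite mxE; apply/eqP.
have zi i : (z i != 0) = (w 0 i != 0).
  by rewrite -(intr_eq0 rat) zE mulf_eq0 (negbTE D0).
have z0 : z i0 != 0 by rewrite zi.
case: (@arg_minnP _ i0 (fun i => z i != 0) (fun i => logn p `|z i|) z0).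
move=> i1 zi1 i1min; pose e := logn p `|z i1|.
have zd i : ((p ^ e)%N %| z i)%Z.
  have [->|/[dup] zn /i1min] := eqVneq (z i) 0; first exact: dvdz0.
  by rewrite -/e dvdzE /= pfactor_dvdn ?absz_gt0.
have p0 : (0 < p)%N by exact: prime_gt0.
exists (fun i => (z i %/ (p ^ e)%N)%Z).
  exists i1; apply/negP => h.
  have : (p ^ e.+1 %| `|z i1|)%N.
    by rewrite -(divzK (zd i1)) abszM /= expnS dvdn_mul.
  by rewrite pfactor_dvdn ?absz_gt0 // ltnn.
have pe0 : ((p ^ e)%N : int)%:~R != 0 :> rat.
  by rewrite intr_eq0 eqz_nat -lt0n expn_gt0 p0.
exists (D / ((p ^ e)%N : int)%:~R); first by rewrite mulf_neq0 ?invr_eq0.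
apply/rowP => i; rewrite !mxE mulrAC -zE.
by rewrite -[in RHS](divzK (zd i)) intrM mulfK.
Qed.

(** If the small lattice vectors had full rank, [N + 1] of them would have a nonzero determinant
    that is divisible by [p ^ (l * N)] and yet smaller. So they are all orthogonal to one nonzero
    rational vector, which is then made primitive at p. *)
Lemma simplex_lemma (p N l h : nat) (y : 'I_N -> int) : prime p ->
  ((N + 1)`! * h ^ (N + 1) < p ^ (l * N))%N ->
  exists2 a : 'I_(N + 1) -> int, (exists i, ~~ (p %| `|a i|)%N) &
    forall v : 'I_(N + 1) -> int, (forall j, (`|v j| <= h)%N) ->
      (forall i, ((p ^ l)%N %| v (lshift 1 i) - v (rshift N ord0) * y i)%Z) ->
      \sum_j a j * v j = 0.
Proof.
move=> p_pr hlt.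
pose I := {ffun 'I_(N + 1) -> 'I_(h.*2.+1)}.
pose vec (f : I) : 'I_(N + 1) -> int := fun j => (f j)%:Z - h%:Z.
pose lat (v : 'I_(N + 1) -> int) :=
  [forall i, ((p ^ l)%N %| v (lshift 1 i) - v (rshift N ord0) * y i)%Z].
(* One row for each integer vector of height at most [h]. Rows outside the lattice are replaced by
   0, so that every row satisfies both the height bound and the congruence. *)
pose M : 'M[int]_(#|{: I}|, N + 1) :=
  \matrix_(k, j) (if lat (vec (enum_val k)) then vec (enum_val k) j else 0).
have Mh k j : (`|M k j| <= h)%N.
  rewrite !mxE; case: ifP => _ //; rewrite /vec.
  by move: (ltn_ord (enum_val k j)); move: (nat_of_ord _) => m; lia.
have Ml k i : ((p ^ l)%N %| M k (lshift 1 i) - M k (rshift N ord0) * y i)%Z.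
  rewrite !mxE; case: ifP => [/forallP/(_ i)//|_].
  by rewrite mul0r subr0 dvdz0.
pose MQ : 'M[rat]_(_, _) := map_mx intr M.
have nfull : ~~ row_full MQ.
  apply/negP => full; have := fullrowsub_unit full.
  rewrite -map_mxsub unitmxE unitfE det_map_mx intr_eq0.
  set A := rowsub _ M; move=> A0.
  have /dvdzP[c cE] : ((p ^ l)%N%:Z ^+ N %| \det A)%Z.
    apply: (@dvdz_det_congruent N _ y) => k i; rewrite !mxE.
    by have := Ml (fullrankfun full k) i; rewrite !mxE.
  have : (`|\det A| <= (N + 1)`! * h ^ (N + 1))%N.
    apply: det_norm_le => i j; rewrite !mxE.
    by have := Mh (fullrankfun full i) j; rewrite !mxE.
  rewrite leqNgt => /negP; apply; apply: leq_trans hlt _.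
  move: A0; rewrite cE -absz_gt0 abszM muln_gt0 => /andP[c0 _].
  by rewrite abszX /= -expnM leq_pmull.
have w0 : nz_row (kermx MQ^T) != 0.
  rewrite nz_row_eq0 -mxrank_eq0 mxrank_ker mxrank_tr subn_eq0 -ltnNge.
  by rewrite ltn_neqAle rank_leq_col andbT.
have [a ap [c c0 ac]] := primitive_multiple p_pr w0.
exists a => // v vh vl.
have aM : \row_i (a i)%:~R *m MQ^T = 0.
  rewrite ac -scalemxAl; have /sub_kermxP -> := nz_row_sub (kermx MQ^T).
  by rewrite scaler0.
pose f : I := [ffun j => inord `|(v j + h%:Z)%R|].
have fv : vec f = v.
  apply/funext => j; rewrite /vec ffunE inordK; have := vh j; lia.
have lv : lat v by apply/forallP.
have /rowP/(_ (enum_rank f)) := aM; rewrite !mxE => aM0.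
apply/eqP; rewrite -(intr_eq0 rat) -[X in _ == X]aM0 rmorph_sum /=; apply/eqP.
by apply: eq_bigr => j _; rewrite !mxE intrM enum_rankK fv lv.
Qed.

(** * Counting, residues, and the balls of a splitting structure *)

Lemma card_eq_II_of_inj (T : Type) (F : finType) (A : set T) (g : T -> F) :
  {in A &, injective g} -> exists2 l, (A #= `I_l)%card & (l <= #|F|)%N.
Proof.
move=> gI; pose g' x := nat_of_ord (enum_rank (g x)).
have g'I : {in A &, injective g'}.
  by move=> x y xA yA /ord_inj/enum_rank_inj/gI; exact.
have leA : (A #<= `I_#|F|)%card.
  rewrite -(card_le_eql (inj_card_eq g'I)); apply: subset_card_le.
  by move=> _ [x _ <-] /=; exact: ltn_ord.
have /finite_setP[l Al] := card_le_finite leA (finite_II _).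
by exists l => //; rewrite -card_le_II -(card_le_eql Al).
Qed.

Lemma res_ge0 (p : nat) (x : padic_int p) k : (0 < p)%N -> 0 <= res x k.
Proof. by move=> p0; rewrite -res_mod modz_ge0 // eqz_nat -lt0n expn_gt0 p0. Qed.

Lemma res_lt (p : nat) (x : padic_int p) k : (0 < p)%N -> res x k < (p ^ k)%N.
Proof. by move=> p0; rewrite -res_mod ltz_pmod // ltz_nat expn_gt0 p0. Qed.

Lemma res_intr (p : nat) (m : int) k :
  res (m%:~R : padic_int p) k = (m %% (p ^ k)%N)%Z.
Proof.
case: m => n; first by rewrite -pmulrn res_nat modz_nat.
rewrite NegzE mulrNz -pmulrn.
have -> : res (- n.+1%:R : padic_int p) k =
  (- res (n.+1%:R : padic_int p) k %% (p ^ k)%N)%Z by [].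
by rewrite res_nat -modz_nat modzNm.
Qed.

Lemma res_linear_form (p : nat) (x : padic_int p) (q r : int) k :
  res (q%:~R * x - r%:~R) k = ((q * res x k - r) %% (p ^ k)%N)%Z.
Proof.
have -> : res (q%:~R * x - r%:~R) k =
  ((((res (q%:~R : padic_int p) k * res x k) %% (p ^ k)%N)%Z +
   (- res (r%:~R : padic_int p) k %% (p ^ k)%N)%Z) %% (p ^ k)%N)%Z by [].
by rewrite !res_intr modzMml modzNm modzDm.
Qed.

Lemma spl_rad_exp (R : realType) (p N : nat)
    (S : splitting_structure R p N) B u b :
  prime p -> splU S u -> spl S B u b ->
  (p ^ rad_exp b)%N = (p ^ rad_exp B * u)%N.
Proof.
move=> p_pr Uu Sb; have := spl_rad Uu Sb; rewrite /pball_rad.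
have p0 : p%:R != 0 :> R by rewrite pnatr_eq0 -lt0n prime_gt0.
have u0 : u%:R != 0 :> R by rewrite pnatr_eq0 -lt0n (splU_gt0 Uu).
rewrite -invfM => /invr_inj /eqP; rewrite -!natrX -natrM eqr_nat => /eqP //.
Qed.

(** A ball of [spl S B u] exists because f(u) > 0. For [B] of radius 1 its radius is 1/u, and radii
    are powers of p. *)
Lemma splU_pow (R : realType) (p N : nat)
    (S : splitting_structure R p N) u :
  prime p -> splU S u -> exists k, u = (p ^ k)%N.
Proof.
move=> p_pr Uu; pose B : pball p N := PBall 0 0.
have [b Sb] : exists b, spl S B u b.
  have /card_eqPle[_ h] := spl_card B Uu.
  have /eqP/set0P[b Sb] : spl S B u <> set0; last by exists b.
  move=> S0; move: h; rewrite S0 card_le0 => /eqP I0.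
  have : `I_(splf S u) 0%N by rewrite /=; exact: splf_gt0.
  by rewrite I0.
have /= := spl_rad_exp p_pr Uu Sb; rewrite expn0 mul1n => E.
by have /(dvdn_pfactor _ _ p_pr)[k _ ->] : (u %| p ^ rad_exp b)%N;
  [rewrite E | exists k].
Qed.

Lemma spl_rad_expD (R : realType) (p N : nat)
    (S : splitting_structure R p N) B k b :
  prime p -> splU S (p ^ k)%N -> spl S B (p ^ k)%N b ->
  rad_exp b = (rad_exp B + k)%N.
Proof.
move=> p_pr Uk Sb; apply/eqP; rewrite -(eqn_exp2l _ _ (prime_gt1 p_pr)).
by rewrite (spl_rad_exp p_pr Uk Sb) expnD.
Qed.

Lemma spl_res (R : realType) (p N : nat)
    (S : splitting_structure R p N) B k b i :
  prime p -> splU S (p ^ k)%N -> spl S B (p ^ k)%N b ->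
  res (cent b 0 i) (rad_exp B) = res (cent B 0 i) (rad_exp B).
Proof.
move=> p_pr Uk Sb; have := spl_sub Uk Sb; rewrite !(pball_setE _ p_pr) => h.
by have /= -> := h (cent b) (fun=> erefl) i.
Qed.

(** Congruent centres are at distance at most rad(b), whereas (S2) puts distinct members at distance
    at least 2 rad(b). *)
Lemma spl_res_inj (R : realType) (p N : nat)
    (S : splitting_structure R p N) B k b b' :
  prime p -> splU S (p ^ k)%N ->
  spl S B (p ^ k)%N b -> spl S B (p ^ k)%N b' ->
  (forall i, res (cent b 0 i) (rad_exp B + k) =
             res (cent b' 0 i) (rad_exp B + k)) -> b = b'.
Proof.
move=> p_pr Uk Sb Sb' h; apply: contrapT => nb.
have := spl_sep Uk Sb Sb' nb; rewrite -mulrA -(spl_rad Uk Sb).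
have : pball_set R b (cent b').
  by rewrite (pball_setE R p_pr) (spl_rad_expD p_pr Uk Sb) => i.
rewrite /pball_set /= => h1 h2; have := le_trans h2 h1.
have : 0 < pball_rad R b.
  by rewrite /pball_rad invr_gt0 exprn_gt0 // ltr0n prime_gt0.
by lra.
Qed.

(** * Balls that contain a rational point of small height *)

(** [int_height] with values in [nat], so that heights compare with powers of p without real
    exponents. *)
Definition nat_height (N : nat) (r : 'I_N -> int) (q : int) : nat :=
  maxn (\max_(i < N) `|r i|) `|q|.

(* b contains the point r/q of Z_p^N for some (r, q) whose height is bounded in
   terms of X; the divisibility is the condition that r/q lies in b. *)
Definition dangerous (p N X : nat) : set (pball p N) :=
  [set b : pball p N | exists (r : 'I_N -> int) (q : int),
    [/\ ~~ (p %| `|q|)%N, (N.+1`! * nat_height r q ^ N.+1 < X)%N &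
        forall i, ((p ^ rad_exp b)%N %|
                   q * res (cent b ord0 i) (rad_exp b) - r i)%Z]].

(** The simplex lemma gives one linear relation satisfied by all the (r, q) involved. Modulo the
    radius of [b], r is q times the centre of [b], and q is a unit, so the relation passes to the
    centre. *)
Lemma dangerous_hyperplane (p N X l : nat) (y : 'I_N -> int) : prime p ->
  (0 < X <= p ^ (l * N))%N ->
  exists a : 'I_N -> int, exists a0 : int,
    ((exists i, ~~ (p %| a i)%Z) \/ ~~ (p %| a0)%Z) /\
    forall b : pball p N, (l <= rad_exp b)%N ->
      (forall i, res (cent b 0 i) l = y i) -> dangerous X b ->
      ((p ^ rad_exp b)%N %|
       \sum_i a i * res (cent b ord0 i) (rad_exp b) + a0)%Z.
Proof.
move=> p_pr /andP[X0 Xl].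
(* The simplex lemma wants a bound on the height itself: [h] is the largest height that [X]
   admits. *)
have [h hX hmax] : exists2 h, (N.+1`! * h ^ N.+1 < X)%N &
    forall h', (N.+1`! * h' ^ N.+1 < X)%N -> (h' <= h)%N.
  pose P h := (N.+1`! * h ^ N.+1 < X)%N.
  have exP : exists h, P h by exists 0%N; rewrite /P exp0n // muln0.
  have bP h : P h -> (h <= X)%N.
    move=> /ltnW; apply: leq_trans; rewrite -[leqLHS]mul1n leq_mul ?fact_gt0 //.
    by case: h => // h; rewrite -{1}(expn1 h.+1) leq_pexp2l.
  by case: (ex_maxnP exP bP) => h; exists h.
have hlt : ((N + 1)`! * h ^ (N + 1) < p ^ (l * N))%N.
  by rewrite addn1; exact: leq_trans hX Xl.
have [a ap aP] := @simplex_lemma p N l h y p_pr hlt.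
exists (a \o lshift 1), (a (rshift N ord0)); split.
  case: ap => i; case: (split_ordP i) => j -> ai; [left; exists j|right] => //.
  by rewrite dvdzE; move: ai; rewrite (ord1 j).
move=> b lb yb [r [q [pq rqX rqb]]].
set e := rad_exp b in lb rqb *; pose x i := res (cent b 0 i) e.
pose v j := row_mx (\row_i r i) (q%:M) (ord0 : 'I_1) j.
have vl i : v (lshift 1 i) = r i by rewrite /v row_mxEl mxE.
have vr : v (rshift N ord0) = q by rewrite /v row_mxEr mxE eqxx.
have vh j : (`|v j| <= h)%N.
  apply: leq_trans (hmax _ rqX); rewrite /nat_height leq_max.
  case: (split_ordP j) => i ->; first by rewrite vl leq_bigmax.
  by rewrite (ord1 i) vr leqnn orbT.
have vd i : ((p ^ l)%N %| v (lshift 1 i) - v (rshift N ord0) * y i)%Z.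
  rewrite vl vr -rpredN opprB -yb -(res_le _ lb).
  have /dvdzP[c cE] : ((p ^ l)%N %| q * x i - r i)%Z.
    by apply: dvdz_trans (rqb i); rewrite dvdzE /= dvdn_exp2l.
  rewrite /modz /= -/(x i) mulrBr addrAC cE.
  by rewrite rpredB ?dvdz_mull // dvdz_mull.
have := aP v vh vd; rewrite big_split_ord big_ord1 /= vr => a0.
have : ((p ^ e)%N %| q * (\sum_i a (lshift 1 i) * x i + a (rshift N ord0)))%Z.
  (* The relation [a0] replaces the constant term times q by minus the sum of the a_i r_i. *)
  rewrite (_ : q * _ = \sum_i a (lshift 1 i) * (q * x i - r i)); last first.
    under [RHS]eq_bigr do rewrite mulrBr.
    rewrite sumrB mulrDr mulr_sumr; move: a0.
    under eq_bigr do rewrite vl.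
    move=> /eqP; rewrite addrC addr_eq0 mulrC => /eqP ->; congr (_ - _).
    by apply: eq_bigr => i _; ring.
  by apply: rpred_sum => i _; apply: dvdz_mull; exact: rqb.
rewrite Gauss_dvdzr // /coprimez /gcdz /= eqz_nat.
by apply: coprimeXl; rewrite prime_coprime.
Qed.

(** The bound makes [x %/ d] smaller than [e], so the reduction modulo [e] loses nothing; it matches
    the values of [g] in [card_dangerous], which lie in ['I_(p ^ K)]. *)
Lemma eq_of_mod_div (d e x x' : nat) :
  (x < d * e)%N -> (x' < d * e)%N -> (x %% d = x' %% d)%N ->
  ((x %/ d) %% e = (x' %/ d) %% e)%N -> x = x'.
Proof.
move=> xd x'd xm; have d0 : (0 < d)%N by case: d xd {x'd xm}.
rewrite !modn_small; [|by rewrite ltn_divLR // mulnC..].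
by move=> xq; rewrite (divn_eq x d) xm xq -divn_eq.
Qed.

(** The centres satisfy one affine congruence with some coefficient [a i0] prime to p, so the
    coordinate [i0] is determined by the [N.-1] others. Each of these is fixed modulo [p ^ j] by
    [B], which leaves [p ^ K] values. *)
Lemma card_dangerous (R : realType) (p N : nat) (S : splitting_structure R p N)
    (B : pball p N) (K X : nat) :
  prime p -> (0 < K)%N -> splU S (p ^ K)%N ->
  (0 < X <= p ^ (rad_exp B * N))%N ->
  exists2 l, (spl S B (p ^ K) `&` @dangerous p N X #= `I_l)%card &
             (l <= (p ^ K) ^ N.-1)%N.
Proof.
move=> p_pr K0 UK hX; set T := _ `&` _; set j := rad_exp B.
have p0 : (0 < p)%N by exact: prime_gt0.
pose x (b : pball p N) i := res (cent b 0 i) (j + K).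
have [a [a0 [prim aP]]] :=
  dangerous_hyperplane (fun i => res (cent B 0 i) j) p_pr hX.
have TE b : T b -> ((p ^ (j + K))%N %| \sum_i a i * x b i + a0)%Z.
  case=> Sb Db; have eb := spl_rad_expD p_pr UK Sb.
  have /= := aP b; rewrite eb leq_addr => /(_ isT) h.
  by apply: h => // i; rewrite (spl_res _ p_pr UK Sb).
have [T0|/set0P[b0 Tb0]] := eqVneq T set0.
  by exists 0%N => //; rewrite T0 II0.
(* If p divided every [a i], the congruence at the dangerous ball [b0] would make p divide [a0] as
   well; [K0] ensures that the modulus is divisible by p. *)
have [i0 ai0] : exists i, ~~ (p %| a i)%Z.
  case: prim => // pa0; apply: contrapT => na; move/negP: pa0; apply.
  have pa i : (p %| a i)%Z.
    by apply/negPn/negP => pai; apply: na; exists i.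
  have : (p %| \sum_i a i * x b0 i + a0)%Z.
    apply: dvdz_trans (TE _ Tb0); rewrite dvdzE /= -{1}(expn1 p) dvdn_exp2l //.
    by rewrite addn_gt0 K0 orbT.
  by rewrite rpredDl //; apply: rpred_sum => i _; rewrite dvdz_mulr.
have pK0 : (0 < p ^ K)%N by rewrite expn_gt0 p0.
(* The top [K] base-p digits of each coordinate other than [i0]. *)
pose g b := [ffun k : 'I_N.-1 =>
  Ordinal (ltn_pmod (`|x b (lift i0 k)| %/ p ^ j)%N pK0)].
have gI : {in T &, injective g}.
  move=> b b' /set_mem Tb /set_mem Tb' /ffunP gb.
  have [Sb _] := Tb; have [Sb' _] := Tb'.
  have xy i : i != i0 -> x b i = x b' i.
    rewrite eq_sym => ii0; have [k ->] := unlift_some ii0.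
    have := gb k; rewrite !ffunE => /(congr1 val) /= {}gb _.
    have xE c : x c (lift i0 k) = `|x c (lift i0 k)|%N by rewrite gez0_abs ?res_ge0.
    rewrite xE [RHS]xE; congr Posz; apply: eq_of_mod_div gb.
    - by rewrite -expnD -ltz_nat -xE res_lt.
    - by rewrite -expnD -ltz_nat -xE res_lt.
    apply/eqP; rewrite -eqz_nat -!modz_nat -!xE !res_le ?leq_addr //.
    by rewrite (spl_res _ p_pr UK Sb) (spl_res _ p_pr UK Sb').
  apply: (spl_res_inj p_pr UK Sb Sb') => i.
  have [->|/xy //] := eqVneq i i0.
  (* In the difference of the two congruences only the term of [i0] survives, and its coefficient is
     invertible modulo powers of p. *)
  have : ((p ^ (j + K))%N %| (\sum_i a i * x b i + a0) -
            (\sum_i a i * x b' i + a0))%Z by rewrite rpredB ?TE.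
  rewrite [X in _ - (X + _)](bigD1 i0) //= (bigD1 i0) //=.
  under eq_bigr => k /xy -> do [].
  rewrite (_ : _ - _ = a i0 * (x b i0 - x b' i0)); last by ring.
  rewrite Gauss_dvdzr; last first.
    rewrite /coprimez /gcdz /= eqz_nat; apply: coprimeXl.
    by rewrite prime_coprime.
  by rewrite -eqz_mod_dvd !res_mod => /eqP.
have [l Tl lle] := card_eq_II_of_inj gI.
by exists l => //; apply: leq_trans lle _; rewrite card_ffun !card_ord.
Qed.

(** * Cantor sets inside the badly approximable points *)

(** The step [k = 0] removes all of [D n]; the later steps remove the empty set, which the sign of
    [r] permits. Thus every intermediate collection below [n.+1] is already [Bn n.+1]. *)
Lemma cantor_collections_single_step (R : realType) (p N : nat)
    (S : splitting_structure R p N) (B : pball p N) (Q : nat)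
    (r : nat -> nat -> R) (D : nat -> set (pball p N))
    (Bn : nat -> set (pball p N)) :
  (forall m n, 0 <= r m n) -> Bn 0%N = [set B] ->
  (forall n, Bn n.+1 = (\bigcup_(b in Bn n) spl S b Q) `\` D n) ->
  (forall n b, Bn n b ->
     exists2 l : nat, (spl S b Q `&` D n #= `I_l)%card & l%:R <= r n n) ->
  cantor_collections S B Q r Bn.
Proof.
move=> r0 B0 BS BD; split=> // n.
exists (fun m => if m == n.+1 then \bigcup_(b in Bn n) spl S b Q else Bn n.+1).
split=> [|k kn|//]; first by rewrite eqxx.
rewrite [_ == n.+1 in X in removal _ _ _ _ _ X]ltn_eqF ?ltnS ?leq_subr //.
case: k kn => [_|k kn].
  rewrite subn0 eqxx expn1; exists (fun b => spl S b Q `&` D n); split.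
    move=> b Bb; split; last exact: BD.
    by move=> b' [Sb' _]; split => //; exists b.
  rewrite BS; apply/seteqP; split => b [[c Bc Sc] nD].
    by split; [exists c | move=> [c' _ []]].
  by split; [exists c | move=> Db; apply: nD; exists c].
rewrite eqSS ltn_eqF; last by rewrite ltn_subrL (leq_ltn_trans _ kn).
exists (fun=> set0); split; last by rewrite bigcup0 // setD0.
move=> b _; split => //; exists 0%N => //; first by rewrite II0.
Qed.

Lemma int_heightE (R : realType) (N : nat) (r : 'I_N -> int) (q : int) :
  int_height R r q = (nat_height r q)%:R.
Proof.
have maxE : {morph (fun n : nat => n%:R : R) : m n / maxn m n >-> Num.max m n}.
  by move=> m n; case: leqP => mn; apply/esym; [apply/max_idPr | apply/max_idPl];
    rewrite ler_nat // ltnW.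
rewrite /int_height /nat_height maxE (big_morph _ maxE erefl) natr_absz.
by congr Num.max; apply: eq_bigr => i _; rewrite natr_absz.
Qed.

(** If z is nonzero modulo p^(k+1), then p z is nonzero modulo p^(k+2). *)
Lemma ler_padic_normM (R : realType) (p : nat) (z : padic_int p) : prime p ->
  padic_norm R z <= p%:R * padic_norm R (p%:R * z).
Proof.
move=> p_pr; have p0 : 0 < p%:R :> R by rewrite ltr0n prime_gt0.
have pn0 m : 0 <= p%:R ^- m :> R by rewrite invr_ge0 exprn_ge0 // ltW.
have n0 y : 0 <= padic_norm R y :> R by rewrite /padic_norm; case: pselect.
rewrite {1}/padic_norm; case: pselect => [h|_]; last by rewrite mulr_ge0 // ltW.
case: ex_minnP => k zk _.
rewrite mulrC -ler_pdivrMr // -invfM -exprSr; apply: norm_gt => //.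
have := res_linear_form z p 0 k.+2; rewrite mulr0z !subr0 -pmulrn => ->.
apply: contra zk => /eqP /dvdz_mod0P; rewrite expnS PoszM dvdz_mul2l; last first.
  by rewrite eqz_nat -lt0n prime_gt0.
by rewrite -(res_le z (leqnSn k.+1)) => /dvdz_mod0P ->.
Qed.

(** Descent on |q|: as long as p divides q and every r_i, divide the whole vector by p. If p divides
    q but not some r_i, then |q x_i - r_i|_p = 1, which suffices since [c <= 1]. *)
Lemma Bad_of_prime_to_p (R : realType) (p N : nat) (x : 'rV[padic_int p]_N)
    (c : R) : prime p -> (0 < N)%N -> 0 < c -> c <= 1 ->
  (forall (r : 'I_N -> int) (q : int), ~~ (p %| `|q|)%N ->
    c * (nat_height r q)%:R `^ (- (N.+1%:R / N%:R)) <=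
    \big[Num.max/0]_(i < N) padic_norm R (q%:~R * x 0 i - (r i)%:~R)) ->
  Bad R x.
Proof.
move=> p_pr N0 c0 c1 cP; set beta := _ / _ in cP; exists c => // r q.
have p0 : (0 < p)%N by exact: prime_gt0.
have pR1 : 1 < p%:R :> R by rewrite ltr1n prime_gt1.
have pR0 : 0 < p%:R :> R by rewrite ltr0n.
have NR0 : 0 < N%:R :> R by rewrite ltr0n.
have b1 : 1 <= beta by rewrite ler_pdivlMr // mul1r ler_nat.
rewrite int_heightE -/beta.
have [n] := ubnP `|q|; elim: n => // n IH in r q *; rewrite ltnS => qn q0.
have [pq|npq] := boolP (p %| `|q|)%N; last exact: cP.
have [/existsP[i nri]|/existsPn pr] := boolP [exists i, ~~ (p %| `|r i|)%N].
  apply: (@le_trans _ _ 1).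
    have H1 : 1 <= (nat_height r q)%:R :> R.
      by rewrite ler1n /nat_height leq_max absz_gt0 q0 orbT.
    rewrite mulr_ile1 ?powR_ge0 // ?(ltW c0) // powRN invf_le1.
      by rewrite -[leLHS](powRr0 (nat_height r q)%:R) ler_powR // (le_trans ler01 b1).
    by rewrite powR_gt0 // (lt_le_trans ltr01).
  apply: le_trans (le_bigmax _ _ i).
  rewrite -[leLHS]invr1 -[leLHS]/(p%:R ^- 0); apply: norm_gt => //.
  rewrite res_linear_form expn1; apply/negP => /eqP/dvdz_mod0P.
  rewrite rpredBl; first by rewrite dvdzE => pri; rewrite pri in nri.
  by rewrite dvdz_mulr.
have pq' : (p %| q)%Z by [].
have pr' i : (p %| r i)%Z by have := pr i; rewrite negbK.
pose q' := (q %/ p)%Z; pose r' i := (r i %/ p)%Z.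
have qE : q = q' * p by rewrite divzK.
have rE i : r i = r' i * p by rewrite divzK.
have q'0 : q' != 0 by apply: contra_neq q0 => q'0; rewrite qE q'0 mul0r.
have q'n : (`|q'| < n)%N.
  apply: leq_trans qn; rewrite qE abszM /= ltn_Pmulr ?prime_gt1 //.
  by rewrite absz_gt0.
have hE : nat_height r q = (p * nat_height r' q')%N.
  rewrite /nat_height qE abszM /= maxnMr [(`|q'| * p)%N]mulnC; congr maxn.
  rewrite (big_morph (muln p) (fun a b => maxnMr p a b) (muln0 p)).
  by apply: eq_bigr => i _; rewrite rE abszM mulnC.
rewrite hE natrM powRM // !powRN.
(* Division by p gains at most a factor p in the norm and p^[beta] in the bound; [1 <= beta] makes
   the comparison go the right way. *)
apply: (@le_trans _ _ (p%:R^-1 * (c * (nat_height r' q')%:R `^ (- beta)))).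
  rewrite mulrCA powRN ler_wpM2r // ?mulr_ge0 ?invr_ge0 ?powR_ge0 ?(ltW c0) //.
  by rewrite lef_pV2 ?posrE ?powR_gt0 // le1r_powR // ltW.
rewrite ler_pdivrMl //; apply: le_trans (IH r' q' q'n q'0) _.
apply/bigmax_leP; split.
  by rewrite mulr_ge0 // ?(ltW pR0) //; exact: bigmax_ge_id.
move=> i _; apply: le_trans (ler_padic_normM _ _ p_pr) _.
rewrite ler_pM2l //; apply: le_trans (le_bigmax _ _ i).
rewrite qE rE !intrM -pmulrn.
by rewrite (_ : p%:R * _ = q'%:~R * p%:R * x 0 i - (r' i)%:~R * p%:R) //; ring.
Qed.

(** An N-th root, with [F] in place of its root since [F] is at least 1. *)
Lemma powR_ratio_ge (R : realType) (N F h X : nat) : (0 < N)%N -> (0 < F)%N ->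
  (X ^ N <= F * h ^ N.+1)%N ->
  X%:R <= F%:R * h%:R `^ (N.+1%:R / N%:R) :> R.
Proof.
move=> N0 F0 XF.
rewrite -(@ler_pXn2r _ N) ?nnegrE ?mulr_ge0 ?powR_ge0 // exprMn.
rewrite -(powR_mulrn N (powR_ge0 _ _)) -powRrM divfK ?pnatr_eq0 -?lt0n //.
rewrite powR_mulrn // -!natrX -natrM ler_nat; apply: leq_trans XF _.
by rewrite leq_mul2r -{1}(expn1 F) leq_pexp2l ?orbT.
Qed.

(** Each (s, q) with q prime to p is handled at the first level whose threshold exceeds its height.
    The ball around x that survives there misses s/q, and minimality of the level bounds its radius
    below in terms of the height. *)
Lemma exists_cantor_set_sub_Bad (R : realType) (p N : nat)
    (S : splitting_structure R p N) (B : pball p N) (K : nat)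
    (r : nat -> nat -> R) :
  prime p -> (0 < N)%N -> (0 < K)%N -> splU S (p ^ K)%N ->
  (forall m n, 0 <= r m n) -> (forall n, ((p ^ K) ^ N.-1)%:R <= r n n) ->
  exists2 C, cantor_set S B (p ^ K) r C & C `<=` @Bad R p N.
Proof.
move=> p_pr N0 K0 UK r0 rn; set Q := (p ^ K)%N; set j := rad_exp B.
have p0 : (0 < p)%N by exact: prime_gt0.
(* The threshold Q^(nN) is at most rad(b)^(-N) for a ball [b] of level n, as [card_dangerous]
   demands; the balls tested are those of level n + 1. *)
pose D n := @dangerous p N (p ^ (n * K * N)).
pose Bn := fix Bn n := if n is m.+1 then
  (\bigcup_(b in Bn m) spl S b Q) `\` D m else [set B].
have radBn n b : Bn n b -> rad_exp b = (j + n * K)%N.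
  elim: n b => [|n IH] b /=; first by move=> ->; rewrite mul0n addn0.
  move=> [[b' /IH eb' Sb] _].
  by rewrite (spl_rad_expD p_pr UK Sb) eb' mulSn -addnA [(n * K + K)%N]addnC.
exists (\bigcap_n union_balls R (Bn n)).
  exists Bn => //; apply: (cantor_collections_single_step r0 erefl) => [//|].
  move=> n b Bnb; have [|l Tl lle] := @card_dangerous R p N S b K
    (p ^ (n * K * N)) p_pr K0 UK.
    rewrite expn_gt0 p0 /= leq_pexp2l // (radBn _ _ Bnb).
    by rewrite leq_mul2r leq_addl orbT.
  by exists l => //; apply: le_trans (rn n); rewrite ler_nat.
move=> x xC; set F := (N.+1)`!.
have F0 : (0 < F)%N by exact: fact_gt0.
(* The exponent [j] comes from the radius of [B], [2 * K] from the two levels between the failing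
   threshold [m] and the ball of level [m.+2], and [F] from the factorial in [dangerous]. *)
pose c : R := p%:R ^- (j + 2 * K) / F%:R.
have pR0 : 0 < p%:R :> R by rewrite ltr0n.
have pn0 m : 0 < p%:R ^- m :> R by rewrite invr_gt0 exprn_gt0.
have c0 : 0 < c by rewrite divr_gt0 ?ltr0n.
have c1 : c <= 1.
  rewrite ler_pdivrMr ?ltr0n // mul1r; apply: (@le_trans _ _ 1); last first.
    by rewrite ler1n.
  by rewrite invf_le1 ?exprn_gt0 // exprn_ege1 // ler1n.
apply: (Bad_of_prime_to_p p_pr N0 c0 c1) => s q pq.
set h := nat_height s q.
have q0 : q != 0 by apply: contra pq => /eqP ->; rewrite dvdn0.
have h0 : (0 < h)%N by rewrite /h /nat_height leq_max absz_gt0 q0 orbT.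
pose P m := (F * h ^ N.+1 < p ^ (m * K * N))%N.
have exP : exists m, P m.
  exists (F * h ^ N.+1)%N; apply: leq_trans (ltn_expl _ (prime_gt1 p_pr)) _.
  by rewrite leq_pexp2l // -mulnA leq_pmulr // muln_gt0 K0.
case: (ex_minnP exP) => -[|m].
  by rewrite /P !mul0n expn0 ltnS leqn0 muln_eq0 expn_eq0 !gtn_eqF.
move=> Pm minm.
have nPm : (p ^ (m * K * N) <= F * h ^ N.+1)%N.
  by rewrite leqNgt; apply/negP => /minm; rewrite ltnn.
(* Level [m.+2] is what remains after the removal of [D m.+1], whose threshold (s, q) meets by [Pm].
   Were all the norms at most rad(b), (s, q) would make [b] dangerous. *)
have [b Bb] := xC m.+2 I; rewrite (pball_setE R p_pr) /= => bx.
have eb := radBn _ _ Bb.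
have [i ni] : exists i, ~~ (padic_norm R (q%:~R * x 0 i - (s i)%:~R) <=
    p%:R ^- rad_exp b).
  apply: contrapT => nex; case: Bb => _; apply; exists s, q; split => // i.
  have : padic_norm R (q%:~R * x 0 i - (s i)%:~R) <= p%:R ^- rad_exp b.
    by apply/negPn/negP => ni; apply: nex; exists i.
  by rewrite (norm_le _ p_pr) res_linear_form bx => /eqP /dvdz_mod0P.
apply: le_trans (le_bigmax _ _ i); move: ni; rewrite -ltNge => /ltW.
apply: le_trans; rewrite eb powRN.
have hb : 0 < h%:R `^ (N.+1%:R / N%:R) :> R by rewrite powR_gt0 // ltr0n.
have := @powR_ratio_ge R N F h (p ^ (m * K)) N0 F0; rewrite -expnM => /(_ nPm) le.
rewrite /c -mulrA -invfM.
have -> : (j + m.+2 * K = (j + 2 * K) + m * K)%N by lia.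
rewrite (exprD _ (j + _)) [leRHS]invfM ler_pM2l // lef_pV2 ?posrE ?exprn_gt0 //.
  by rewrite -natrX.
by rewrite mulr_gt0 ?ltr0n.
Qed.

(** * An upper bound for the Hausdorff dimension of [A_infty] *)

(** Ultrametric: every point of a ball is a centre of it. *)
Lemma hausdorff_diam_pball (R : realType) (p N : nat) (b : pball p N) :
  prime p ->
  (hausdorff_diam (@padic_dist R p N) (pball_set R b) <= (pball_rad R b)%:E)%E.
Proof.
move=> p_pr; apply: ge_ereal_sup => _ [[x y] /= [bx bY] <-]; rewrite lee_fin.
have -> : pball_rad R b = pball_rad R (PBall x (rad_exp b)) by [].
suff : pball_set R (PBall x (rad_exp b)) y by [].
move: bx bY; rewrite !(pball_setE R p_pr) /= => bx bY i.
by rewrite -bx.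
Qed.

Lemma hausdorff_diam_ge0 (R : realType) (p N : nat) (V : set 'rV[padic_int p]_N) :
  V !=set0 -> (0 <= hausdorff_diam (@padic_dist R p N) V)%E.
Proof.
move=> [x Vx]; apply: le_ereal_sup_tmp.
exists (padic_dist R x x)%:E; first by exists (x, x).
by rewrite lee_fin; exact: bigmax_ge_id.
Qed.

Lemma hausdorff_premeasure_le_cover (R : realType) (p N : nat)
    (A : set 'rV[padic_int p]_N) (F : set (pball p N)) (k l : nat) (s delta : R) :
  prime p -> 0 < s -> (F #= `I_k)%card ->
  (forall b, F b -> rad_exp b = l) -> A `<=` union_balls R F ->
  p%:R ^- l <= delta ->
  (hausdorff_premeasure (@padic_dist R p N) s delta A <=
   (k%:R * (p%:R ^- l) `^ s)%:E)%E.
Proof.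
move=> p_pr s0 /card_set_bijP[f [fF fI fS]] Fl AF ld.
(* The ball numbered [i] by [f], and the empty set, of weight 0, from [k] on: the finite cover
   becomes a sequence. *)
pose V i := \bigcup_(b in F `&` f @^-1` [set i]) pball_set R b.
have VE b : F b -> V (f b) = pball_set R b.
  move=> Fb; apply/seteqP; split => [x [b' [Fb' fb'] bx]|x bx]; last by exists b.
  by rewrite (fI _ _ (mem_set Fb) (mem_set Fb') (esym fb')).
have V0 i : (k <= i)%N -> V i = set0.
  move=> ki; rewrite -subset0 => x [b [Fb fb] _].
  by have := fF b Fb; rewrite /= fb ltnNge ki.
pose dist := @padic_dist R p N.
have pl0 : 0 <= p%:R ^- l :> R by rewrite invr_ge0 exprn_ge0.
have Vd i : (hausdorff_diam dist (V i) <= (p%:R ^- l)%:E)%E.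
  have [ik|ki] := ltnP i k.
    have [b Fb <-] := fS i ik.
    by rewrite VE // -(Fl b Fb); exact: hausdorff_diam_pball.
  by rewrite V0 //; apply: ge_ereal_sup => _ [? [[]]].
have w0 W : (0 <= hausdorff_weight dist s W)%E.
  by rewrite /hausdorff_weight; case: ifP => // _; exact: poweR_ge0.
have wV i : (hausdorff_weight dist s (V i) <= ((p%:R ^- l) `^ s)%:E)%E.
  rewrite /hausdorff_weight; case: ifPn => [_|/set0P Vi].
    by rewrite lee_fin powR_ge0.
  rewrite -poweR_EFin; apply: (gt0_ler_poweR (ltW s0)) => //.
  - by rewrite in_itv /= leey andbT; exact: hausdorff_diam_ge0.
  - by rewrite in_itv /= leey andbT lee_fin.
apply: (@le_trans _ _ (\sum_(0 <= i <oo) hausdorff_weight dist s (V i))%E).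
  apply: ereal_inf_lbound; exists V => //.
  split=> [x /AF[b Fb bx]|i]; first by exists (f b) => //; rewrite VE.
  by apply: le_trans (Vd i) _; rewrite lee_fin.
rewrite (nneseries_split 0 k) // [X in (_ + X)%E]eseries0 ?adde0.
  rewrite add0n; apply: le_trans (lee_sum _ (fun i _ => wV i)) _.
  by rewrite big_mkord sumEFin lee_fin sumr_const card_ord mulr_natl.
move=> i; rewrite add0n => ki _.
by rewrite /hausdorff_weight V0 ?eqxx.
Qed.

Lemma hausdorff_measure_eq0 (R : realType) (X : Type) (dist : X -> X -> R) (s : R)
    (A : set X) :
  (forall delta eta : R, 0 < delta -> 0 < eta ->
     (hausdorff_premeasure dist s delta A <= eta%:E)%E) ->
  hausdorff_measure dist s A = 0%E.
Proof.
move=> small; apply/eqP; rewrite eq_le; apply/andP; split.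
  apply: ge_ereal_sup => _ [delta /= d0 <-].
  by apply/lee_addgt0Pr => eta eta0; rewrite add0e; exact: small.
apply: le_ereal_sup_tmp; exists (hausdorff_premeasure dist s 1 A).
  by exists 1 => //=; exact: ltr01.
apply: le_ereal_inf_tmp => _ [V _ <-]; apply: nneseries_ge0 => i _ _.
by rewrite /hausdorff_weight; case: ifP => // _; exact: poweR_ge0.
Qed.

(** For each e > 0, the f(u_i) balls of S(B, u_i), of radius at most 1/u_i, have total weight at
    most u_i^a u_i^(-(a+e)) = u_i^(-e), which tends to 0. *)
Lemma hausdorff_dim_A_infty_le (R : realType) (p N : nat)
    (S : splitting_structure R p N) (B : pball p N) (u : nat -> nat) (a : R) :
  prime p -> 0 <= a -> divisibility_chain S u ->
  (forall i, (splf S (u i))%:R <= (u i)%:R `^ a) ->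
  (hausdorff_dim (@padic_dist R p N) (A_infty S u B) <= a%:E)%E.
Proof.
move=> p_pr a0 [uU _ uoo] fu; apply/lee_addgt0Pr => e e0.
apply: ereal_inf_lbound; exists (a + e) => //; split.
  by rewrite addr_ge0 // ltW.
apply: hausdorff_measure_eq0 => delta eta d0 eta0.
(* The first bound gives 1/u_i <= [delta], the second u_i^(-e) <= [eta]. *)
pose M := maxn (Num.bound delta^-1) (Num.bound (eta^-1 `^ e^-1)).
have [i Mi] : exists i, (M <= u i)%N.
  by have /cvgnyPge/(_ M)/filter_ex := uoo.
have [k uk] := splU_pow p_pr (uU i).
have p0 : 0 < p%:R :> R by rewrite ltr0n prime_gt0.
have u0 : 0 < (u i)%:R :> R by rewrite ltr0n (splU_gt0 (uU i)).
have pku : p%:R ^- (rad_exp B + k) <= (u i)%:R^-1 :> R.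
  rewrite lef_pV2 ?posrE ?exprn_gt0 // uk natrX ler_weXn2l ?leq_addl //.
  by rewrite ler1n prime_gt0.
have ud : (u i)%:R^-1 <= delta.
  rewrite invf_ple ?posrE //; apply: ltW; apply: lt_le_trans (archi_boundP _) _.
    by rewrite invr_ge0 ltW.
  by rewrite ler_nat; apply: leq_trans Mi; rewrite leq_maxl.
have ue : (u i)%:R `^ (- e) <= eta.
  rewrite powRN invf_ple ?posrE ?powR_gt0 //.
  have <- : (eta^-1 `^ e^-1) `^ e = eta^-1.
    by rewrite -powRrM mulVf ?gt_eqF // powRr1 // invr_ge0 ltW.
  apply: (ge0_ler_powR (ltW e0)); rewrite ?nnegrE ?powR_ge0 //; apply: ltW.
  apply: lt_le_trans (archi_boundP (powR_ge0 _ _)) _.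
  by rewrite ler_nat; apply: leq_trans Mi; rewrite leq_maxr.
apply: (@le_trans _ _ ((splf S (u i))%:R *
    (p%:R ^- (rad_exp B + k)) `^ (a + e))%:E).
  apply: (hausdorff_premeasure_le_cover p_pr _ (spl_card B (uU i))).
  - by rewrite ltr_wpDl.
  - move=> b; have := uU i; rewrite uk => Uk Sb.
    exact: (spl_rad_expD p_pr Uk Sb).
  - by move=> x /(_ i); exact.
  - exact: le_trans pku ud.
rewrite lee_fin; apply: le_trans ue.
rewrite (_ : - e = a + (-1) * (a + e)); last by ring.
rewrite [leRHS]powRD; last by rewrite (gt_eqF u0) implybT.
rewrite powRrM powR_inv1 ?(ltW u0) //; apply: ler_pM; rewrite ?powR_ge0 //.
by apply: ge0_ler_powR;
  rewrite ?nnegrE ?addr_ge0 ?invr_ge0 ?exprn_ge0 ?(ltW u0) ?(ltW e0).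
Qed.

(** * The exponent of f, and the winning property *)

Lemma splf_exp (R : realType) (p N : nat) (S : splitting_structure R p N) u n :
  splU S u -> splf S (u ^ n) = (splf S u ^ n)%N.
Proof.
move=> Uu.
have U1 : splU S 1.
  by have := splU_div Uu Uu (dvdnn u); rewrite divnn (splU_gt0 Uu).
have f1 : splf S 1 = 1%N.
  have /eqP := splf_mul U1 U1; rewrite muln1 -{1}[splf S 1]muln1.
  by rewrite eqn_pmul2l ?splf_gt0 // eq_sym => /eqP.
have Un m : splU S (u ^ m)%N.
  by elim: m => [|m IH]; rewrite ?expn0 // expnS; exact: splU_mul.
elim: n => [|n IH]; first by rewrite !expn0.
by rewrite !expnS splf_mul // IH.
Qed.

(** With u = p^k and v = p^l one has v^k = u^l, hence f(v)^k = f(u)^l: the ratio log f / log is the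
    same at u and v. *)
Lemma splf_powR (R : realType) (p N : nat) (S : splitting_structure R p N) u v :
  prime p -> splU S u -> splU S v -> (1 < u)%N ->
  (splf S v)%:R = v%:R `^ (ln (splf S u)%:R / ln u%:R) :> R.
Proof.
move=> p_pr Uu Uv u1; set a := _ / _.
have [k uk] := splU_pow p_pr Uu; have [l vl] := splU_pow p_pr Uv.
have k0 : (0 < k)%N by case: k uk u1 => [->|].
have fu : u%:R `^ a = (splf S u)%:R.
  rewrite /powR pnatr_eq0 gtn_eqF ?(ltn_trans _ u1) // /a divfK; last first.
    by rewrite gt_eqF // ln_gt0 // ltr1n.
  by rewrite lnK // posrE ltr0n splf_gt0.
apply: (@pexpIrn _ _ k0); rewrite ?nnegrE ?powR_ge0 // -natrX -splf_exp //.
rewrite -(powR_mulrn k (powR_ge0 _ _)) powRAC powR_mulrn // -natrX.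
have -> : (v ^ k = u ^ l)%N by rewrite uk vl -!expnM mulnC.
by rewrite splf_exp // !natrX -fu -!powR_mulrn ?powR_ge0 // powRAC.
Qed.

(** On the diagonal m = n the allowance is f(Q)^(1-eps) = Q^(a(1-eps)), which covers the Q^(N-1)
    removals. The threshold [Q0] serves for every eps, as it only has to force Q > 1. *)
Lemma cantor_winning_on_Bad (R : realType) (p N : nat)
    (S : splitting_structure R p N) (B : pball p N) (a eps0 : R) (Q0 : nat) :
  prime p -> (0 < N)%N -> splU S Q0 -> (1 < Q0)%N ->
  (forall u, splU S u -> (splf S u)%:R = u%:R `^ a :> R) ->
  (forall eps : R, 0 < eps -> eps < eps0 -> N%:R - 1 <= a * (1 - eps)) ->
  cantor_winning_on S eps0 (@Bad R p N) B.
Proof.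
move=> p_pr N0 UQ0 Q01 fE ha eps e0 e1; exists Q0 => // Q UQ Q0Q.
have [K QK] := splU_pow p_pr UQ; rewrite {}QK in UQ Q0Q *.
have Q1 : (1 < p ^ K)%N by exact: leq_trans Q0Q.
have K0 : (0 < K)%N by case: K Q1 {UQ Q0Q}.
apply: exists_cantor_set_sub_Bad => // n.
rewrite subnn mul1r fE // -powRrM natrX -powR_mulrn //.
apply: ler_powR; first by rewrite ler1n ltnW.
by rewrite -subn1 natrB //; exact: ha.
Qed.

Theorem theorem14 (R : realType) (p N : nat) (p_prime : prime p)
    (N_gt0 : (0 < N)%N) :
  (forall (B : pball p N) (S : splitting_structure R p N)
      (u : nat -> nat) (d : R),
    nontrivial_splitting S ->
    divisibility_chain S u ->
    hausdorff_dim (@padic_dist R p N) (A_infty S u B) = d%:E ->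
    N%:R - 1 < d ->
    cantor_winning_on S ((d - N%:R + 1) / d) (@Bad R p N) B)
  /\
  (forall S : splitting_structure R p N, canonical_splitting S ->
    cantor_winning S (1 / N%:R) (@Bad R p N)).
Proof.
have NR1 : 1 <= N%:R :> R by rewrite ler1n.
split=> [B S u d _ chain dimE Nd|S [UE fE _] B].
  have [uU _ uoo] := chain.
  (* An element of U above 1, from which the exponent [a] of f is read off. *)
  have [i ui] : exists i, (2 <= u i)%N.
    by have /cvgnyPge/(_ 2)/filter_ex := uoo.
  have fE v (Uv : splU S v) := splf_powR p_prime (uU i) Uv ui.
  set a := ln _ / _ in fE.
  have a0 : 0 <= a.
    by rewrite divr_ge0 // ln_ge0 // ler1n ?splf_gt0 // ltnW.
  have da : d <= a.
    rewrite -lee_fin -dimE; apply: hausdorff_dim_A_infty_le => // j.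
    by rewrite fE.
  apply: (cantor_winning_on_Bad B p_prime N_gt0 (uU i) ui fE) => eps e0.
  have d0 : 0 < d by lra.
  rewrite ltr_pdivlMr // => ed.
  (* [ed] says N - 1 < d (1 - eps); nonnegativity of 1 - eps then allows d to be replaced by the
     larger [a]. *)
  have e1 : 0 <= 1 - eps by nra.
  apply: (@le_trans _ _ (d * (1 - eps))); first by lra.
  by rewrite ler_wpM2r.
(* Here f(p^k) = (p^k)^N gives the exponent [N%:R] directly, without the dimension of [A_infty]. *)
apply: (@cantor_winning_on_Bad R p N S B N%:R _ p) => //.
- by rewrite UE; exists 1%N; rewrite ?expn1.
- exact: prime_gt1.
- move=> v; rewrite {1}UE => -[k _ <-].
  by rewrite fE mulnC expnM powR_mulrn // natrX.
move=> eps e0; rewrite ltr_pdivlMr; last by lra.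
by move=> eN; lra.
Qed.
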